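(* Let $T=U(1)^m$, let $U\subset G\subset T$ be closed subgroups such that $G/U$ is a $1$-dimensional torus, put $R=T/G$, $\tilde R=T/U$, and write $\mathbb{Z}[\tilde R^*]=H^*(B\tilde R;\mathbb{Z})=\mathbb{Z}[u_1,\dots,u_n,u_{n+1}]$, where $\mathbb{Z}[u_1,\dots,u_n]=H^*(BR;\mathbb{Z})=\mathbb{Z}[R^*]$. Let $M$ be a graded $\mathbb{Z}[x_1,\dots,x_m]$-module. In the long exact sequence (the algebraic Gysin sequence) $$\cdots\to\operatorname{Tor}_{i+1}^{\mathbb{Z}[R^*]}(M,\mathbb{Z})\xrightarrow{\delta}\operatorname{Tor}_{i+1}^{\mathbb{Z}[R^*]}(M,\mathbb{Z})\xrightarrow{\tau^*}\operatorname{Tor}_{i+1}^{\mathbb{Z}[\tilde R^*]}(M,\mathbb{Z})\xrightarrow{\tau_*}\operatorname{Tor}_{i}^{\mathbb{Z}[R^*]}(M,\mathbb{Z})\xrightarrow{\delta}\operatorname{Tor}_{i}^{\mathbb{Z}[R^*]}(M,\mathbb{Z})\to\cdots$$ the connecting map $\delta$ is multiplication by $u_{n+1}$, and it is independent of the choice of $u_{n+1}$.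
   Context: $\mathbb{Z}[x_1,\dots,x_m]=H^*(BT;\mathbb{Z})$ with $\deg x_j=2$. The rings $\mathbb{Z}[R^*]=H^*(BR;\mathbb{Z})\subset\mathbb{Z}[\tilde R^*]=H^*(B\tilde R;\mathbb{Z})\subset H^*(BT;\mathbb{Z})$ are regarded as subrings via the quotient maps $T\to\tilde R\to R$. Here $u_1,\dots,u_n$ is a $\mathbb{Z}$-basis of $H^2(BR;\mathbb{Z})$ and $u_{n+1}$ is a degree-$2$ element completing it to a $\mathbb{Z}$-basis of $H^2(B\tilde R;\mathbb{Z})$. For $p\in\{n,n+1\}$ let $K(\xi_1,\dots,\xi_p)=\mathbb{Z}[\tilde R^*]\otimes\Lambda(\xi_1,\dots,\xi_p)$ be the Koszul complex over $\mathbb{Z}[\tilde R^*]$ (with $\Lambda$ the exterior algebra), with differential the derivation extending $\partial\xi_i=u_i$. There is a short exact sequence of complexes $$0\to K(\xi_1,\dots,\xi_n)\xrightarrow{\tau^*}K(\xi_1,\dots,\xi_n,\xi_{n+1})\xrightarrow{\tau_*}K(\xi_1,\dots,\xi_n)[-1]\to0,$$ where $\tau^*$ is the inclusion and $\tau_*$ removes $\xi_{n+1}\wedge$, i.e. sends $a+\xi_{n+1}\wedge z\mapsto z$ for $a,z\in K(\xi_1,\dots,\xi_n)$ (with the usual sign convention for the differential of the shift). Tensoring with $M$ over $\mathbb{Z}[\tilde R^*]$ and taking homology gives the long exact sequence in the claim, since the homology of $M\otimes K(\xi_1,\dots,\xi_n)$ is $\operatorname{Tor}_*^{\mathbb{Z}[R^*]}(M,\mathbb{Z})$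 and that of $M\otimes K(\xi_1,\dots,\xi_{n+1})$ is $\operatorname{Tor}_*^{\mathbb{Z}[\tilde R^*]}(M,\mathbb{Z})$, where $\mathbb{Z}$ is the module on which all $u_i$ act by $0$; $\delta$ is the connecting homomorphism. Multiplication by $u_{n+1}$ on $\operatorname{Tor}_*^{\mathbb{Z}[R^*]}(M,\mathbb{Z})$ is induced by its action on $M$.
   Formalization: Independence of the choice of u_{n+1} fails literally, since −u_{n+1} is also a valid choice and negates δ; what is proved is that another choice differs from ±u_{n+1} by an element of H²(BR), and δ is unchanged in the + case and becomes −δ in the − case. *)

(* Defs.v *)
From HB Require Import structures.
From mathcomp Require Import all_boot all_order all_algebra.
From mathcomp Require Import boolp classical_sets reals topology normedtype.
From mathcomp Require Import complex.
From mathcomp Require Import ring_quotient.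
(* the notations of mpoly clash with those of MathComp-Analysis *)
From mathcomp Require Import -(notations) mpoly.

Set Implicit Arguments.
Unset Strict Implicit.
Unset Printing Implicit Defensive.

Import Order.TTheory GRing.Theory Num.Theory numFieldNormedType.Exports.

Local Open Scope classical_set_scope.
Local Open Scope ring_scope.

(* R[i] has no topology of its own; seen as a numClosedFieldType it gets the
   one induced by the modulus. *)
Definition Cplx (R : realType) : numClosedFieldType := R[i].

Definition U1 (R : realType) : set (Cplx R) := [set z | `|z| = 1].

Section Torus.
Variables (R : realType) (m : nat).
Local Notation vec := 'rV[Cplx R]_m.

Definition torus : set vec := [set t | forall j, U1 (t 0 j)].

Definition tmul (s t : vec) : vec := \row_j (s 0 j * t 0 j).
Definition tinv (t : vec) : vec := \row_j (t 0 j)^-1.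

(* T is closed in C^m, so closed in C^m is the same as closed in T *)
Definition closed_subgroup (H : set vec) : Prop :=
  [/\ H `<=` torus, closed H, H (const_mx 1),
      forall s t, H s -> H t -> H (tmul s t)
    & forall t, H t -> H (tinv t)].

(* G/U is a one-dimensional torus, i.e. G/U and U(1) are isomorphic topological
   groups. A continuous homomorphism G/U -> U(1) is a continuous homomorphism
   on G that is trivial on U; being bijective on the compact group G/U, it is a
   homeomorphism. *)
Definition quotient_is_circle (G U : set vec) : Prop :=
  exists phi : vec -> Cplx R,
    [/\ {within G, continuous phi},
        forall s t, G s -> G t -> phi (tmul s t) = phi s * phi t,
        phi @` G = @U1 R
      & forall t, G t -> (phi t = 1 <-> U t)].

Definition chi (a : 'I_m -> int) (t : vec) : Cplx R := \prod_j t 0 j ^ a j.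

(* H^*(BT; Z) = Z[x_1, ..., x_m] *)
Definition HBT : comNzRingType := mpoly m int.
Definition xvar (j : 'I_m) : HBT := mpolyX int (mnm1 j).

(* The subgroup H^2(B(T/H); Z) of H^2(BT; Z). For a torus S, H^2(BS; Z) is the
   group of characters of S (via the first Chern class); x_j corresponds to the
   j-th coordinate character of T, and the characters of T/H are those of T that
   are trivial on H. *)
Definition H2B (H : set vec) : set HBT :=
  [set v | exists a : 'I_m -> int,
     v = \sum_j xvar j *~ a j /\ forall t, H t -> chi a t = 1].

End Torus.

Definition is_Zbasis (V : zmodType) (L : set V) (p : nat) (u : 'I_p -> V) :=
  (forall i, L (u i)) /\
  (forall v, L v -> exists! c : {ffun 'I_p -> int}, v = \sum_i u i *~ c i).

Definition extend (V : Type) (n : nat) (u : 'I_n -> V) (v : V) (i : 'I_n.+1) : V :=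
  if unlift ord_max i is Some j then u j else v.

(* gr k is the part of degree k, with deg x_j = 2 *)
Definition is_grading (m : nat) (M : lmodType (HBT m)) (gr : int -> set M) :=
  [/\ forall k, gr k 0 /\ (forall a b, gr k a -> gr k b -> gr k (a - b)),
      forall k j a, gr k a -> gr (k + 2) (xvar j *: a),
      forall a, exists (s : seq int) (c : int -> M),
        (forall k, gr k (c k)) /\ a = \sum_(k <- s) c k
    & forall (s : seq int) (c : int -> M), uniq s -> (forall k, gr k (c k)) ->
        \sum_(k <- s) c k = 0 -> forall k, k \in s -> c k = 0].

(* The i-th term of the complex C is the submodule [deg C i] of C. *)
Record complex (A : comNzRingType) := Complex {
  ambient :> lmodType A;
  deg : int -> set ambient;
  diff : {linear ambient -> ambient};
  deg_submod : forall i, deg i 0 /\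
    (forall a x y, deg i x -> deg i y -> deg i (a *: x + y));
  diff_deg : forall i x, deg i x -> deg (i - 1) (diff x);
  diffK : forall x, diff (diff x) = 0
}.
Arguments deg {A} c i _.
Arguments diff {A} c.

Section Homology.
Variables (A : comNzRingType) (C : complex A) (i : int).

Definition cycle : {pred C} := [pred x : C | `[< deg C i x >] && (diff C x == 0)].

Fact cycle_submod : submod_closed cycle.
Proof.
have [d0 dl] := deg_submod C i.
split=> [|a x y]; rewrite !inE ?linear0 ?eqxx ?andbT; first exact/asboolP.
move=> /andP[/asboolP xi /eqP dx] /andP[/asboolP yi /eqP dy].
rewrite linearP dx dy scaler0 addr0 eqxx andbT; apply/asboolP; exact: dl.
Qed.
HB.instance Definition _ := GRing.isSubmodClosed.Build A C cycle cycle_submod.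

Record cycles := Cycle { cycle_val :> C; _ : cycle_val \in cycle }.
HB.instance Definition _ := [isSub for cycle_val].
HB.instance Definition _ := [Choice of cycles by <:].
HB.instance Definition _ := [SubChoice_isSubLmodule of cycles by <:].

Definition boundary : {pred cycles} :=
  [pred z : cycles | `[< exists2 y, deg C (i + 1) y & diff C y = val z >]].

Fact boundary_zmod : zmod_closed boundary.
Proof.
have [d0 dl] := deg_submod C (i + 1).
split=> [|x y]; rewrite !inE.
  by exists 0; rewrite ?linear0.
move=> [x' x'i dx'] [y' y'i dy'].
exists (- 1 *: y' + x'); first exact: dl.
by rewrite linearP dx' dy' scaleN1r addrC raddfB.
Qed.
HB.instance Definition _ := GRing.isZmodClosed.Build cycles boundary boundary_zmod.

Fact boundaryZ a z : z \in boundary -> a *: z \in boundary.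
Proof.
have [d0 dl] := deg_submod C (i + 1).
rewrite !inE => -[y yi dy].
exists (a *: y); last by rewrite !linearZ /= dy.
by rewrite -[_ *: y]addr0; apply: dl.
Qed.

Definition homology : Type := Quotient.quot boundary.
HB.instance Definition _ := GRing.Zmodule.on homology.

Definition hclass (z : cycles) : homology := \pi_(Quotient.quot boundary)%qT z.

Definition hrepr (c : homology) : cycles := repr c.

Lemma hreprK c : hclass (hrepr c) = c.
Proof. exact: reprK. Qed.

Lemma hclass_eq x y : (hclass x = hclass y) <-> x - y \in boundary.
Proof.
by rewrite (Quotient.idealrBE boundary); split=> [/eqP|/eqP].
Qed.

Definition hscale (a : A) (c : homology) : homology := hclass (a *: hrepr c).

Lemma hclassD x y : hclass (x + y) = hclass x + hclass y.
Proof. exact: raddfD. Qed.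

Lemma hclassZ a x : hclass (a *: x) = hscale a (hclass x).
Proof.
apply/hclass_eq; rewrite -scalerBr; apply: boundaryZ.
by apply/hclass_eq; rewrite hreprK.
Qed.

Fact hscaleA a b c : hscale a (hscale b c) = hscale (a * b) c.
Proof. by rewrite -[c]hreprK -!hclassZ scalerA. Qed.
Fact hscale1 : left_id 1 hscale.
Proof. by move=> c; rewrite -[c]hreprK -!hclassZ scale1r. Qed.
Fact hscaleDr : right_distributive hscale +%R.
Proof.
by move=> a b c; rewrite -[b]hreprK -[c]hreprK -hclassD -!hclassZ scalerDr hclassD.
Qed.
Fact hscaleDl c : {morph hscale^~ c : a b / a + b}.
Proof. by move=> a b; rewrite -[c]hreprK -!hclassZ scalerDl hclassD. Qed.

HB.instance Definition _ := GRing.Zmodule_isLmodule.Build A homology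
  hscaleA hscale1 hscaleDr hscaleDl.

(* junk value 0 when x is not a cycle of degree i *)
Definition hclass_of (x : C) : homology := hclass (insubd 0 x).

End Homology.

Record chain_map (A : comNzRingType) (C D : complex A) := ChainMap {
  chain_fun :> {linear C -> D};
  chain_deg : forall i x, deg C i x -> deg D i (chain_fun x);
  chain_diff : forall x, chain_fun (diff C x) = diff D (chain_fun x)
}.

Definition short_exact (A : comNzRingType) (C' C C'' : complex A)
    (f : chain_map C' C) (g : chain_map C C'') : Prop :=
  forall i,
    [/\ forall x, deg C' i x -> f x = 0 -> x = 0,
        forall y, deg C i y -> (g y = 0 <-> exists2 x, deg C' i x & f x = y)
      & forall z, deg C'' i z -> exists2 y, deg C i y & g y = z].

Definition hmap (A : comNzRingType) (C D : complex A) (f : chain_map C D) (i : int)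
  (c : homology C i) : homology D i := hclass_of i (f (val (hrepr c))).

(* The connecting homomorphism of 0 -> C' -> C -> C'' -> 0: lift a representing
   cycle of c to y in C, and take the class of the x in C' mapped to the
   boundary of y. *)
Definition connecting (A : comNzRingType) (C' C C'' : complex A)
    (f : chain_map C' C) (g : chain_map C C'') (i : int)
    (c : homology C'' (i + 1)) : homology C' i :=
  hclass_of i (xget 0 [set x : C' | deg C' i x /\
    exists y : C, [/\ deg C (i + 1) y, g y = val (hrepr c) & f x = diff C y]]).

Section Shift.
Variables (A : comNzRingType) (C : complex A).

Fact shift_diff_deg i (x : C) :
  deg C (i - 1) x -> deg C (i - 1 - 1) ((\- diff C) x).
Proof.
move=> /diff_deg xi; have [d0 dl] := deg_submod C (i - 1 - 1).
by rewrite /= -scaleN1r -[_ *: _]addr0; apply: dl.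
Qed.

Fact shift_diffK (x : C) : (\- diff C) ((\- diff C) x) = 0.
Proof. by rewrite /= linearN diffK !oppr0. Qed.

Definition shift : complex A :=
  @Complex A C (fun i => deg C (i - 1)) (\- diff C)
    (fun i => deg_submod C (i - 1)) shift_diff_deg shift_diffK.

(* H_i(C) and H_{i+1}(C[-1]) have the same cycles and the same boundaries; these
   are the mutually inverse identifications. *)
Definition hshift i (c : homology C i) : homology shift (i + 1) :=
  @hclass_of A shift (i + 1) (val (hrepr c)).
Definition hunshift i (c : homology shift (i + 1)) : homology C i :=
  @hclass_of A C i (val (hrepr c)).

End Shift.

Definition exact_at (X Y Z : zmodType) (f : X -> Y) (g : Y -> Z) : Prop :=
  forall y, g y = 0 <-> exists x, f x = y.

Section Koszul.
Variables (A : comNzRingType) (M : lmodType A).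

Section KoszulComplex.
Variables (p : nat) (u : 'I_p -> A).

(* An element f of M (x) Lambda(xi_1, ..., xi_p) is given by its coefficients:
   it is the sum over S of f S (x) xi_S, where, for S = {s_1 < ... < s_k},
   xi_S = xi_{s_1} /\ ... /\ xi_{s_k}. *)
Definition koszul_mod := {ffun {set 'I_p} -> M}.
HB.instance Definition _ := GRing.Lmodule.on koszul_mod.

Definition koszul_deg (i : int) : set koszul_mod :=
  [set f | forall S : {set 'I_p}, f S != 0 -> #|S|%:Z = i].

(* number of elements of S before j: xi_j /\ xi_S = (-1)^pos * xi_{j |: S} *)
Definition pos (j : 'I_p) (S : {set 'I_p}) : nat := #|[set k in S | (k < j)%N]|.

(* Since the differential is the derivation with d xi_j = u_j,
   d (m (x) xi_S) = sum over j in S of (-1)^(pos j S) u_j m (x) xi_(S \ j). *)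
Definition koszul_diff (f : koszul_mod) : koszul_mod :=
  [ffun S : {set 'I_p} =>
     \sum_(j | j \notin S) (-1) ^+ pos j S *: (u j *: f (j |: S))].

Fact koszul_diff_linear : linear koszul_diff.
Proof.
move=> a f g; apply/ffunP => S; rewrite !ffunE scaler_sumr -big_split /=.
apply: eq_bigr => j _; rewrite !ffunE !scalerDr; congr (_ + _).
by rewrite !scalerA -[in RHS]mulrA [in RHS]mulrC.
Qed.
HB.instance Definition _ :=
  GRing.isLinear.Build A koszul_mod koszul_mod *:%R koszul_diff koszul_diff_linear.

Fact koszul_deg_submod i : koszul_deg i 0 /\
  (forall a f g, koszul_deg i f -> koszul_deg i g -> koszul_deg i (a *: f + g)).
Proof.
split=> [S|a f g fi gi S]; first by rewrite ffunE eqxx.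
rewrite !ffunE => h; have [f0|/fi //] := eqVneq (f S) 0.
by apply: gi; rewrite f0 scaler0 add0r in h.
Qed.

Fact koszul_diff_deg i f : koszul_deg i f -> koszul_deg (i - 1) (koszul_diff f).
Proof.
move=> fi S; rewrite ffunE => h.
have /existsP[j /andP[jS fj]] : [exists j, (j \notin S) && (f (j |: S) != 0)].
  apply: contraNT h => /existsPn h; apply/eqP; apply: big1 => j jS.
  by have := h j; rewrite jS negbK => /eqP ->; rewrite !scaler0.
by rewrite -(fi _ fj) cardsU1 jS add1n intS addrAC subrr add0r.
Qed.

Fact posU1 (j k : 'I_p) (S : {set 'I_p}) : j \notin S ->
  pos k (j |: S) = (pos k S + (j < k))%N.
Proof.
move=> jS; rewrite /pos; case: ltnP => jk.
  rewrite addn1 -[RHS](_ : #|j |: [set l in S | (l < k)%N]| = _).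
    by apply: eq_card => l; rewrite !inE; case: eqVneq => [->|//]; rewrite jk.
  by rewrite cardsU1 inE (negPf jS).
rewrite addn0; apply: eq_card => l; rewrite !inE.
by case: eqVneq => [->|//]; rewrite ltnNge jk (negPf jS).
Qed.

Fact koszul_diffK f : koszul_diff (koszul_diff f) = 0.
Proof.
apply/ffunP => S; rewrite !ffunE.
pose F (j k : 'I_p) : M := ((-1) ^+ pos j S * (-1) ^+ pos k (j |: S)) *:
  ((u j * u k) *: f (k |: (j |: S))).
have FN j k : j \notin S -> k \notin S -> (j < k)%N -> F k j = - F j k.
  move=> jS kS jk; rewrite /F (posU1 _ jS) (posU1 _ kS) jk ltnNge (ltnW jk) /=.
  rewrite addn0 addn1 exprS mulN1r mulrN scaleNr opprK.
  by rewrite [(-1) ^+ pos k S * _]mulrC [u k * _]mulrC finset.setUCA.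
transitivity (\sum_(j | j \notin S) \sum_(k | (k \notin S) && (k != j)) F j k).
  apply: eq_bigr => j jS; rewrite ffunE !scaler_sumr.
  apply: eq_big => [k|k _]; first by rewrite !inE negb_or andbC.
  by rewrite /F !scalerA; congr (_ *: _); rewrite mulrA; congr (_ * _); rewrite mulrAC.
pose lt := \sum_(j | j \notin S) \sum_(k | (k \notin S) && (j < k)%N) F j k.
suff -> : \sum_(j | j \notin S) \sum_(k | (k \notin S) && (k != j)) F j k
    = lt + - lt by rewrite subrr.
transitivity (lt + \sum_(j | j \notin S) \sum_(k | (k \notin S) && (k < j)%N) F j k).
  rewrite /lt -big_split; apply: eq_bigr => j jS /=.
  rewrite (bigID (fun k : 'I_p => (j < k)%N)) /=; congr (_ + _); apply: eq_bigl => k.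
    by rewrite -andbA; congr (_ && _); rewrite -val_eqE /=; case: ltngtP.
  by rewrite -andbA; congr (_ && _); rewrite -val_eqE /=; case: ltngtP.
congr (_ + _); rewrite /lt -sumrN.
rewrite (exchange_big_dep (fun k : 'I_p => k \notin S)) /=; last first.
  by move=> j k _ /andP[].
apply: eq_bigr => k kS; rewrite -sumrN; apply: eq_big => [j|j].
  by rewrite kS.
by move=> /and3P[jS _ kj]; apply: FN.
Qed.

(* K(u_1, ..., u_p; M) = M (x) K(xi_1, ..., xi_p) *)
Definition koszul : complex A :=
  @Complex A koszul_mod koszul_deg koszul_diff koszul_deg_submod koszul_diff_deg
    koszul_diffK.

(* For A = H^*(BT) and u a Z-basis of H^2(BR), the subring of A generated by u is
   the polynomial ring Z[R^*] = Z[u_1, ..., u_p], the Koszul complex over it is a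
   free resolution of Z (on which the u_i act by 0), and this is
   Tor_i^{Z[R^*]}(M, Z). *)
Definition Tor (i : int) := homology koszul i.

End KoszulComplex.

Section Gysin.
Variables (n : nat) (u : 'I_n -> A) (v : A).
Local Notation K := (koszul u).
Local Notation K' := (koszul (extend u v)).

Definition up (S : {set 'I_n}) : {set 'I_n.+1} := [set lift ord_max j | j in S].
Definition down (S : {set 'I_n.+1}) : {set 'I_n} := [set j | lift ord_max j \in S].

Fact extend_lift j : extend u v (lift ord_max j) = u j.
Proof. by rewrite /extend liftK. Qed.
Fact extend_max : extend u v ord_max = v.
Proof. by rewrite /extend unlift_none. Qed.
Fact mem_up j (S : {set 'I_n}) : (lift ord_max j \in up S) = (j \in S).
Proof. by rewrite mem_imset //; apply: lift_inj. Qed.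
Fact max_up (S : {set 'I_n}) : ord_max \notin up S.
Proof. by apply/imsetP => -[j _ /eqP]; rewrite (negPf (neq_lift _ _)). Qed.
Fact upK (S : {set 'I_n}) : down (up S) = S.
Proof. by apply/setP => j; rewrite inE mem_up. Qed.
Fact downU1 j (S : {set 'I_n.+1}) : down (lift ord_max j |: S) = j |: down S.
Proof. by apply/setP => k; rewrite !inE (inj_eq (@lift_inj _ _)). Qed.
Fact upU1 j (S : {set 'I_n}) : up (j |: S) = lift ord_max j |: up S.
Proof. by rewrite /up imsetU1. Qed.
Fact downK (S : {set 'I_n.+1}) : ord_max \notin S -> up (down S) = S.
Proof.
move=> mS; apply/setP => k; case: (unliftP ord_max k) => [j|] ->.
  by rewrite mem_up inE.
by rewrite (negPf mS) (negPf (max_up _)).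
Qed.
Fact downUmax (S : {set 'I_n.+1}) : down (ord_max |: S) = down S.
Proof. by apply/setP => k; rewrite !inE eq_sym (negPf (neq_lift _ _)). Qed.
Fact card_up (S : {set 'I_n}) : #|up S| = #|S|.
Proof. by rewrite card_imset //; apply: lift_inj. Qed.
Fact pos_lift j (S : {set 'I_n.+1}) : pos (lift ord_max j) S = pos j (down S).
Proof.
rewrite /pos -card_up; apply: eq_card => k; case: (unliftP ord_max k) => [l|] ->.
  by rewrite mem_up !inE !lift_max.
by rewrite (negPf (max_up _)) !inE lift_max ltnNge (ltnW (ltn_ord j)) andbF.
Qed.

Definition incl (f : K) : K' :=
  [ffun S : {set 'I_n.+1} => if ord_max \in S then 0 else (f : koszul_mod n) (down S)].

(* z |-> xi_{n+1} /\ z *)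
Definition wedge_last (z : K) : K' :=
  [ffun S : {set 'I_n.+1} => if ord_max \in S
     then (-1) ^+ #|down S| *: (z : koszul_mod n) (down S) else 0].

(* a + xi_{n+1} /\ z |-> z; the sign comes from
   xi_{n+1} /\ xi_S = (-1)^#|S| xi_{S u {n+1}} *)
Definition strip (g : K') : K :=
  [ffun S : {set 'I_n} => (-1) ^+ #|S| *: (g : koszul_mod n.+1) (ord_max |: up S)].

Lemma stripE a z : strip (incl a + wedge_last z) = z.
Proof.
apply/ffunP => S; rewrite !ffunE setU11 add0r downUmax upK scalerA -exprMn.
by rewrite mulrNN mulr1 expr1n scale1r.
Qed.

Lemma incl_wedgeE (g : K') : exists a z, g = incl a + wedge_last z.
Proof.
exists [ffun S => (g : koszul_mod n.+1) (up S)], (strip g).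
apply/ffunP => S; rewrite !ffunE; case: ifPn => mS; last first.
  by rewrite addr0 downK.
rewrite add0r scalerA -exprMn mulrNN mulr1 expr1n scale1r.
congr (fun_of_fin _ _); apply/setP => k; rewrite !inE.
case: (unliftP ord_max k) => [l|] ->; last by rewrite mS eqxx.
by rewrite mem_up inE eq_sym (negPf (neq_lift _ _)).
Qed.

Fact incl_linear : linear incl.
Proof.
move=> a f g; apply/ffunP => S; rewrite !ffunE.
by case: ifP => _ //; rewrite scaler0 addr0.
Qed.
HB.instance Definition _ := GRing.isLinear.Build A K K' *:%R incl incl_linear.

Fact incl_deg i (f : K) : deg K i f -> deg K' i (incl f).
Proof.
move=> fi S; rewrite ffunE; case: ifPn; first by rewrite eqxx.
by move=> mS /fi <-; rewrite -card_up downK.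
Qed.

Fact incl_diff (f : K) : incl (diff K f) = diff K' (incl f).
Proof.
apply/ffunP => S; rewrite !ffunE; case: ifPn => mS.
  by rewrite big1 // => j _; rewrite !ffunE !inE mS orbT !scaler0.
rewrite (bigD1_ord ord_max) //= !ffunE setU11 !scaler0 add0r.
apply: eq_big => [j|j _]; first by rewrite inE.
by rewrite ffunE pos_lift extend_lift downU1 !inE (negPf (neq_lift _ _)) (negPf mS).
Qed.

Definition incl_map : chain_map K K' := @ChainMap A K K' incl incl_deg incl_diff.

Fact strip_linear : linear strip.
Proof.
move=> a f g; apply/ffunP => S; rewrite !ffunE scalerDr.
by rewrite !scalerA mulrC.
Qed.
HB.instance Definition _ :=
  GRing.isLinear.Build A K' (shift K) *:%R strip strip_linear.

Fact strip_deg i (g : K') : deg K' i g -> deg (shift K) i (strip g).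
Proof.
move=> gi S; rewrite ffunE => h.
have {}h : (g : koszul_mod n.+1) (ord_max |: up S) != 0.
  by apply: contraNneq h => ->; rewrite scaler0.
by rewrite -(gi _ h) cardsU1 max_up card_up add1n intS addrAC subrr add0r.
Qed.

Fact strip_diff (g : K') : strip (diff K' g) = diff (shift K) (strip g).
Proof.
apply/ffunP => S; rewrite !ffunE scaler_sumr -sumrN.
rewrite big_mkcond (bigD1_ord ord_max) //= setU11 add0r [RHS]big_mkcond /=.
apply: eq_bigr => j _; rewrite !inE eq_sym (negPf (neq_lift _ _)) mem_up /=.
case: ifPn => // jS; rewrite ffunE cardsU1 jS add1n pos_lift downUmax upK extend_lift.
rewrite upU1 finset.setUCA exprS mulN1r !scaleNr !scalerN opprK !scalerA.
by rewrite -mulrA mulrC.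
Qed.

Definition strip_map : chain_map K' (shift K) :=
  @ChainMap A K' (shift K) strip strip_deg strip_diff.

Lemma koszul_short_exact : short_exact incl_map strip_map.
Proof.
have stripI (f : K) : strip (incl f) = 0.
  by apply/ffunP => S; rewrite !ffunE setU11 scaler0.
have wedge0 : wedge_last 0 = 0.
  by apply/ffunP => S; rewrite !ffunE scaler0 if_same.
have restr_deg i (g : K') : deg K' i g ->
    deg K i [ffun S => (g : koszul_mod n.+1) (up S)].
  by move=> gi S; rewrite ffunE => /gi; rewrite card_up.
move=> i; split=> [f _ f0|g gi|z zi].
- apply/ffunP => S; have /ffunP/(_ (up S)) := f0.
  by rewrite !ffunE (negPf (max_up _)) upK.
- split=> [g0|[f fi <-]]; last exact: stripI.
  exists [ffun S => (g : koszul_mod n.+1) (up S)]; first exact: restr_deg.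
  have [a [z gE]] := incl_wedgeE g.
  have z0 : z = 0 by rewrite -(stripE a z) -gE; exact: g0.
  rewrite gE z0 wedge0 addr0; congr incl.
  by apply/ffunP => S; rewrite !ffunE (negPf (max_up _)) upK.
exists (wedge_last z); last by rewrite /= -[RHS](stripE 0 z) linear0 add0r.
move=> S; rewrite ffunE; case: ifPn => mS; last by rewrite eqxx.
move=> h; have {}h : (z : koszul_mod n) (down S) != 0.
  by apply: contraNneq h => ->; rewrite scaler0.
have -> : S = ord_max |: up (down S).
  apply/setP => k; rewrite in_setU1; case: (unliftP ord_max k) => [l|] ->.
    by rewrite mem_up inE eq_sym (negPf (neq_lift _ _)).
  by rewrite mS eqxx.
by rewrite cardsU1 max_up card_up add1n intS (zi _ h) addrC subrK.
Qed.

Definition tau_up (i : int) : Tor u i -> Tor (extend u v) i := @hmap _ _ _ incl_map i.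

Definition tau_down (i : int) (c : Tor (extend u v) (i + 1)) : Tor u i :=
  hunshift (hmap strip_map c).

Definition gysin_delta (i : int) (c : Tor u i) : Tor u i :=
  connecting incl_map strip_map (hshift c).

End Gysin.
End Koszul.

Arguments Tor {A} M {p} u i.
Arguments tau_up {A} M {n} u v i c.
Arguments tau_down {A} M {n} u v i c.
Arguments gysin_delta {A} M {n} u v i c.

(* Main.v *)
(* A cycle z of K(xi_1, ..., xi_n) lifts along tau_* to xi_{n+1} /\ z, whose
   boundary is u_{n+1} z; so the connecting map is multiplication by u_{n+1}.
   Multiplication by each of u_1, ..., u_n is homotopic to zero, the homotopy
   being xi_i /\ _, so delta depends only on u_{n+1} modulo u_1, ..., u_n. Two
   completions of (u_1, ..., u_n) to a basis of the same group differ modulo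
   u_1, ..., u_n by a unit of Z, that is, by a sign. *)
Require Import Defs.
From mathcomp Require Import all_boot all_order all_algebra.
From mathcomp Require Import boolp classical_sets reals topology normedtype.
From mathcomp Require Import ring.

Set Implicit Arguments.
Unset Strict Implicit.
Unset Printing Implicit Defensive.

Import Order.TTheory GRing.Theory Num.Theory.
Local Open Scope classical_set_scope.
Local Open Scope ring_scope.

(** * Homology classes of explicit cycles *)

Section HomologyClasses.
Variables (A : comNzRingType) (C : complex A).

(** Cycles as bare elements of [C], the form in which [hclass_of] takes its argument; the subtype
    [cycles] then stays out of the diagram chases. *)
Definition is_cycle (i : int) (x : C) := deg C i x /\ diff C x = 0.

Lemma cycleP i x : reflect (is_cycle i x) (x \in Defs.cycle (C := C) i).
Proof.
rewrite inE; apply: (iffP andP) => [[/asboolP xi /eqP dx]|[xi dx]] //.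
by split; [apply/asboolP|apply/eqP].
Qed.

Lemma degD i x y : deg C i x -> deg C i y -> deg C i (x + y).
Proof.
by have [_ dl] := deg_submod C i; move=> /dl /[apply] /(_ 1); rewrite scale1r.
Qed.

Lemma degZ i a x : deg C i x -> deg C i (a *: x).
Proof. by have [d0 dl] := deg_submod C i; move=> xi; rewrite -[_ *: _]addr0; apply: dl. Qed.

Lemma degB i x y : deg C i x -> deg C i y -> deg C i (x - y).
Proof. by move=> xi yi; rewrite -scaleN1r; apply: degD => //; apply: degZ. Qed.

Lemma is_cycleZ i a x : is_cycle i x -> is_cycle i (a *: x).
Proof. by move=> [xi dx]; split; [exact: degZ|rewrite linearZ_LR dx scaler0]. Qed.

Lemma is_cycle_diff i x : deg C (i + 1) x -> is_cycle i (diff C x).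
Proof. by move=> /diff_deg; rewrite addrK => xi; split=> //; apply: diffK. Qed.

Lemma is_cycle_repr i (c : homology C i) : is_cycle i (val (hrepr c)).
Proof. exact/cycleP/valP. Qed.

Lemma hclass_of_repr i (c : homology C i) : hclass_of i (val (hrepr c)) = c.
Proof. by rewrite /hclass_of valKd hreprK. Qed.

Lemma hclass_ofP i (c : homology C i) : exists2 x, is_cycle i x & hclass_of i x = c.
Proof. by exists (val (hrepr c)); [apply: is_cycle_repr|apply: hclass_of_repr]. Qed.

Lemma hclass_of_eq i x y : is_cycle i x -> is_cycle i y ->
  hclass_of i x = hclass_of i y <-> exists2 w, deg C (i + 1) w & diff C w = x - y.
Proof.
move=> /cycleP xc /cycleP yc; rewrite hclass_eq inE /=.
by rewrite (insubdK _ xc) (insubdK _ yc).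
Qed.

Lemma hclass_ofZ i a x : is_cycle i x -> hclass_of i (a *: x) = a *: hclass_of i x.
Proof.
move=> xc; rewrite -[RHS]hclassZ; congr hclass; apply: val_inj.
by rewrite linearZ /= !insubdK //; apply/cycleP => //; apply: is_cycleZ.
Qed.

Lemma hclass_of0 i : hclass_of i 0 = 0 :> homology C i.
Proof.
rewrite -[0 in LHS](scale0r 0) hclass_ofZ ?scale0r //.
by split; [have [] := deg_submod C i|rewrite linear0].
Qed.

Lemma hclass_of_eq0 i x : is_cycle i x ->
  hclass_of i x = 0 <-> exists2 w, deg C (i + 1) w & diff C w = x.
Proof.
move=> xc; rewrite -(hclass_of0 i) hclass_of_eq ?subr0 //.
by rewrite -(scale0r x); apply: is_cycleZ.
Qed.

(** Maps on homology are defined through the chosen representative [hrepr]. The chain [w] found here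
    is what allows any other representing cycle to be used in its place. *)
Lemma hclass_of_repr_hclass i x : is_cycle i x ->
  exists2 w, deg C (i + 1) w & diff C w = val (hrepr (hclass_of i x)) - x.
Proof.
move=> xc; apply/(hclass_of_eq (is_cycle_repr _) xc); exact: hclass_of_repr.
Qed.

End HomologyClasses.

(** * Induced maps on homology *)

Section ChainMaps.
Variables (A : comNzRingType) (C D : complex A) (f : chain_map C D).

Lemma is_cycle_map i x : is_cycle i x -> is_cycle i (f x).
Proof.
by move=> [xi dx]; split; [exact: chain_deg|rewrite -chain_diff dx linear0].
Qed.

Lemma hmapE i x : is_cycle i x -> hmap f (hclass_of i x) = hclass_of i (f x).
Proof.
move=> xc; apply/hclass_of_eq; [exact/is_cycle_map/is_cycle_repr|exact: is_cycle_map|].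
have [w wi dw] := hclass_of_repr_hclass xc; exists (f w); first exact: chain_deg.
by rewrite -chain_diff dw linearB.
Qed.

End ChainMaps.

(** * The long exact sequence of a short exact sequence of complexes *)

Section LongExactSequence.
Variables (A : comNzRingType) (C' C C'' : complex A).
Variables (f : chain_map C' C) (g : chain_map C C'').
Hypothesis fg : short_exact f g.

Lemma short_exact_inj i x : deg C' i x -> f x = 0 -> x = 0.
Proof. by have [inj _ _] := fg i; apply: inj. Qed.

Lemma short_exact_comp i x : deg C' i x -> g (f x) = 0.
Proof.
have [_ mid _] := fg i; move=> xi; apply/mid; first exact: chain_deg.
by exists x.
Qed.

Lemma short_exact_ker i y : deg C i y -> g y = 0 -> exists2 x, deg C' i x & f x = y.
Proof. by have [_ mid _] := fg i; move=> /mid[]. Qed.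

Lemma short_exact_surj i z : deg C'' i z -> exists2 y, deg C i y & g y = z.
Proof. by have [_ _ surj] := fg i; apply: surj. Qed.

Lemma is_cycle_inj i x : deg C' i x -> diff C (f x) = 0 -> is_cycle i x.
Proof.
move=> xi dfx; split=> //; apply: (@short_exact_inj (i - 1)); first exact: diff_deg.
by rewrite chain_diff.
Qed.

Lemma connecting_lift i z : is_cycle (i + 1) z ->
  exists x y, [/\ deg C' i x, deg C (i + 1) y, g y = z & f x = diff C y].
Proof.
move=> [zi dz]; have [y yi gy] := short_exact_surj zi.
have [||x xi fx] := @short_exact_ker i (diff C y).
- by rewrite -[i](addrK 1); apply: diff_deg.
- by rewrite chain_diff gy.
by exists x, y.
Qed.

(** The connecting map does not depend on the representative or on its lift: two lifts of homologous
    cycles differ by a boundary plus an element [f x'], and [x'] bounds the difference of the two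
    results. *)
Lemma connectingE i z x y : is_cycle (i + 1) z -> deg C' i x -> deg C (i + 1) y ->
  g y = z -> f x = diff C y ->
  connecting f g (hclass_of (i + 1) z) = hclass_of i x.
Proof.
move=> zc xi yi gy fx; rewrite /connecting.
(* An admissible choice exists, so [xget] does not return its default value 0. *)
have [x1 [y1 [x1i y1i gy1 fx1]]] :=
  connecting_lift (is_cycle_repr (hclass_of (i + 1) z)).
case: xgetP => [x0 _ /= [x0i [y0 [y0i gy0 fx0]]]|/(_ x1)]; last first.
  by case; split=> //; exists y1.
apply/hclass_of_eq.
- by apply: is_cycle_inj; rewrite ?fx0 ?diffK.
- by apply: is_cycle_inj; rewrite ?fx ?diffK.
have [w wi dw] := hclass_of_repr_hclass zc.
(* The boundary of a lift of [w] corrects [y0 - y] so that it lies in the kernel of [g]. *)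
have [w' w'i gw'] := short_exact_surj wi.
have [||x' x'i fx'] := @short_exact_ker (i + 1) (y0 - y - diff C w').
- apply: degB; first exact: degB.
  by have [] := is_cycle_diff w'i.
- by rewrite !linearB /= chain_diff gw' dw gy0 gy subrr.
exists x' => //; apply/eqP; rewrite -subr_eq0; apply/eqP.
apply: (@short_exact_inj i); first by do 2?[apply: degB => //]; have [] := is_cycle_diff x'i.
have dy : f (x0 - x) = diff C (y0 - y) by rewrite linearB fx0 fx -linearB.
by rewrite linearB chain_diff fx' dy -linearB addrAC subrr sub0r linearN diffK oppr0.
Qed.

Lemma exact_connecting_hmap i : exact_at (@connecting _ _ _ _ f g i) (@hmap _ _ _ f i).
Proof.
move=> c; have [x xc <-] := hclass_ofP c; have [xi dx] := xc.
rewrite hmapE // hclass_of_eq0; last exact: is_cycle_map.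
split=> [[y yi dy]|[e]].
  exists (hclass_of (i + 1) (g y)); apply: (@connectingE _ _ _ y) => //.
  split; first exact: chain_deg.
  by rewrite -chain_diff dy; apply: short_exact_comp xi.
have [z zc <-] := hclass_ofP e; have [x1 [y [x1i yi gy fx1]]] := connecting_lift zc.
rewrite (connectingE zc x1i yi gy fx1) .
have x1c : is_cycle i x1 by apply: is_cycle_inj; rewrite ?fx1 ?diffK.
move=> /(hclass_of_eq x1c xc)[w wi dw].
(* [f x1] bounds by [y], and [x1 - x] bounds by [w]; hence [f x] bounds by this difference. *)
exists (y - f w); first by apply: degB => //; apply: chain_deg.
by rewrite linearB /= -chain_diff dw linearB /= fx1 subKr.
Qed.

Lemma exact_hmap i : exact_at (@hmap _ _ _ f i) (@hmap _ _ _ g i).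
Proof.
move=> c; have [y yc <-] := hclass_ofP c; have [yi dy] := yc.
rewrite hmapE // hclass_of_eq0; last exact: is_cycle_map.
split=> [[w wi dw]|[e]].
  have [w' w'i gw'] := short_exact_surj wi.
  have dw'i := is_cycle_diff w'i.
  (* Subtracting a boundary moves [y], within its homology class, into the kernel of [g]. *)
  have [||x xi fx] := @short_exact_ker i (y - diff C w').
  - by apply: degB => //; case: dw'i.
  - by rewrite linearB /= chain_diff gw' dw subrr.
  have xc : is_cycle i x by apply: is_cycle_inj; rewrite // fx linearB /= dy diffK subr0.
  exists (hclass_of i x); rewrite hmapE //; apply/hclass_of_eq => //.
    exact: is_cycle_map.
  exists (- 1 *: w'); first exact: degZ.
  by rewrite linearZ_LR /= fx scaleN1r addrC addKr.
have [x xc <-] := hclass_ofP e; have [xi _] := xc.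
rewrite hmapE // => /(hclass_of_eq (is_cycle_map f xc) yc)[w wi dw].
exists (- 1 *: g w); first by apply: degZ; apply: chain_deg.
by rewrite linearZ_LR /= -chain_diff dw scaleN1r linearB /= (short_exact_comp xi) sub0r opprK.
Qed.

Lemma exact_hmap_connecting i :
  exact_at (@hmap _ _ _ g (i + 1)) (@connecting _ _ _ _ f g i).
Proof.
move=> c; have [z zc <-] := hclass_ofP c.
have [x [y [xi yi gy fx]]] := connecting_lift zc.
rewrite (connectingE zc xi yi gy fx) hclass_of_eq0; last first.
  by apply: is_cycle_inj; rewrite ?fx ?diffK.
split=> [[w wi dw]|[e]].
  (* If [x] bounds [w], then [f w] and [y] have the same boundary, so [y - f w] is a cycle that
     still lies over [z]. *)
  have yc : is_cycle (i + 1) (y - f w).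
    split; first by apply: degB => //; apply: chain_deg.
    by rewrite linearB /= -chain_diff dw fx subrr.
  exists (hclass_of (i + 1) (y - f w)); rewrite hmapE // linearB /= gy.
  by rewrite (short_exact_comp wi) subr0.
have [y1 y1c <-] := hclass_ofP e; have [y1i dy1] := y1c.
rewrite hmapE // => /(hclass_of_eq (is_cycle_map g y1c) zc)[w wi dw].
have [w' w'i gw'] := short_exact_surj wi.
have dw'c := is_cycle_diff w'i.
have [||x' x'i fx'] := @short_exact_ker (i + 1) (y - y1 + diff C w').
- by apply: degD; [exact: degB|case: dw'c].
- by rewrite linearD linearB /= chain_diff gw' dw gy addrC subrKA subrr.
exists x' => //; apply/eqP; rewrite -subr_eq0; apply/eqP.
apply: (@short_exact_inj i); first by apply: degB => //; case: (is_cycle_diff x'i).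
by rewrite linearB chain_diff fx' linearD diffK linearB dy1 fx subr0 addr0 subrr.
Qed.

End LongExactSequence.

(** * Identification of the homology of a complex with that of its shift *)

Section ShiftHomology.
Variables (A : comNzRingType) (C : complex A).

Lemma is_cycle_shift i (x : C) : is_cycle (C := Defs.shift C) (i + 1) x <-> is_cycle i x.
Proof.
rewrite /is_cycle /= addrK; split=> -[xi dx]; split=> //.
  by apply/eqP; rewrite -oppr_eq0; apply/eqP.
by rewrite dx oppr0.
Qed.

Lemma hshiftE i (x : C) : is_cycle i x ->
  hshift (hclass_of i x) = @hclass_of A (Defs.shift C) (i + 1) x.
Proof.
move=> xc; apply/hclass_of_eq; try by apply/is_cycle_shift => //; apply: is_cycle_repr.
(* The shifted differential is the negative of the old one, so a bounding chain changes sign. *)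
have [w wi dw] := hclass_of_repr_hclass xc; exists (- 1 *: w).
  by rewrite /= addrK; apply: degZ.
by rewrite /= linearZ_LR /= scaleN1r opprK.
Qed.

Lemma hunshiftE i (x : C) : is_cycle i x ->
  hunshift (@hclass_of A (Defs.shift C) (i + 1) x) = hclass_of i x.
Proof.
move=> xc; have xs := (is_cycle_shift i x).2 xc; apply/hclass_of_eq => //.
  exact/is_cycle_shift/is_cycle_repr.
have [w wi dw] := hclass_of_repr_hclass xs; exists (- 1 *: w).
  by rewrite /= addrK in wi; apply: degZ.
by rewrite linearZ_LR /= scaleN1r.
Qed.

Lemma hshiftK i : cancel (@hshift _ C i) (@hunshift _ C i).
Proof. by move=> c; have [x xc <-] := hclass_ofP c; rewrite hshiftE ?hunshiftE. Qed.

Lemma hunshiftK i : cancel (@hunshift _ C i) (@hshift _ C i).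
Proof.
move=> c; have [x /is_cycle_shift xc <-] := hclass_ofP c.
by rewrite hunshiftE ?hshiftE.
Qed.

Lemma hunshift0 i : hunshift (0 : homology (Defs.shift C) (i + 1)) = 0.
Proof.
have x0 : is_cycle (C := C) i 0.
  by split; [case: (deg_submod C i)|rewrite linear0].
by rewrite -(hclass_of0 (Defs.shift C) (i + 1)) hunshiftE ?hclass_of0.
Qed.

End ShiftHomology.

(** * Koszul homology: the action of the [u i] on Tor *)

Section KoszulTor.
Variables (A : comNzRingType) (M : lmodType A).

Section Annihilation.
Variables (p : nat) (u : 'I_p -> A).

(* z |-> xi_i /\ z *)
Definition wedge (i : 'I_p) (z : koszul M u) : koszul M u :=
  [ffun S : {set 'I_p} => if i \in S
     then (-1) ^+ pos i (S :\ i) *: (z : koszul_mod M p) (S :\ i) else 0].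

Lemma wedge_deg (i : 'I_p) k (z : koszul M u) :
  deg (koszul M u) k z -> deg (koszul M u) (k + 1) (wedge i z).
Proof.
move=> zk S; rewrite ffunE; case: ifPn => iS; last by rewrite eqxx.
move=> h; have {}h : (z : koszul_mod M p) (S :\ i) != 0.
  by apply: contraNneq h => ->; rewrite scaler0.
by rewrite -(zk _ h) (cardsD1 i S) iS add1n intS addrC.
Qed.

(** The Leibniz rule [d (xi_i /\ z) = u_i z - xi_i /\ d z] for a cycle [z], checked on
    coefficients. *)
Lemma diff_wedge (i : 'I_p) (z : koszul M u) : diff (koszul M u) z = 0 ->
  diff (koszul M u) (wedge i z) = u i *: z.
Proof.
move=> dz; apply/ffunP => S; rewrite !ffunE.
have [iS|iS] := boolP (i \in S); last first.
  (* For [i] outside [S], only [j = i] puts [i] into [j |: S]; its two equal signs cancel. *)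
  rewrite (bigD1 i) //= ffunE finset.setU11 finset.setU1K // big1 ?addr0 => [|j /andP[jS ji]].
    by rewrite !scalerA mulrAC -exprMn mulrNN mulr1 expr1n mul1r.
  by rewrite ffunE in_setU1 eq_sym (negPf ji) (negPf iS) !scaler0.
(* For [i] in [S], the equation [d z = 0] at [S :\ i] expresses [u i *: z S] by the terms with [j]
   outside [S]. *)
have /ffunP/(_ (S :\ i)) := dz; rewrite !ffunE (bigD1 i) ?finset.setD11 //= finset.setD1K //.
move=> /(congr1 (fun x => (-1) ^+ pos i (S :\ i) *: x)).
rewrite scaler0 scalerDr scalerA -exprMn mulrNN mulr1 expr1n scale1r.
move=> /eqP; rewrite addr_eq0 => /eqP ->; rewrite scaler_sumr -sumrN.
apply: eq_big => [j|j jS].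
  by rewrite !inE; case: eqVneq => [->|]; rewrite ?iS ?andbT.
have ji : j != i by apply: contraNneq jS => ->.
have e : (j |: S) :\ i = j |: (S :\ i).
  by apply/setP => k; rewrite !inE; case: (eqVneq k j) => [->|]; rewrite ?ji.
rewrite ffunE in_setU1 iS orbT e posU1; last by rewrite !inE (negPf jS) andbF.
rewrite -{1}(finset.setD1K iS) posU1 ?finset.setD11 // !scalerA -scaleNr; congr (_ *: _).
(* Exactly one of the two positions is raised by one, according to the order of [i] and [j]; this
   gives the single sign that is needed. *)
have /orP[ij|ij] : (i < j)%N || (j < i)%N by rewrite -neq_ltn eq_sym.
  by rewrite ij ltnNge (ltnW ij) addn0 addn1 exprS; ring.
by rewrite ij ltnNge (ltnW ij) addn0 addn1 exprS; ring.
Qed.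

Lemma Tor_annihilated (i : 'I_p) k (c : Tor M u k) : u i *: c = 0.
Proof.
have [z zc <-] := hclass_ofP c; have [zk dz] := zc.
rewrite -hclass_ofZ //; apply/hclass_of_eq0; first exact: is_cycleZ.
by exists (wedge i z); [exact: wedge_deg|exact: diff_wedge].
Qed.

Lemma Tor_annihilated_sum k (c : Tor M u k) (b : 'I_p -> int) :
  (\sum_i u i *~ b i) *: c = 0.
Proof.
rewrite scaler_suml big1 // => i _.
by rewrite -mulrzr mulrC -scalerA Tor_annihilated scaler0.
Qed.

End Annihilation.

(** * The connecting map and exactness of the Gysin sequence *)

Section GysinSequence.
Variables (n : nat) (u : 'I_n -> A) (v : A).

Lemma wedge_last_deg i (z : koszul M u) : deg (koszul M u) i z ->
  deg (koszul M (extend u v)) (i + 1) (wedge_last v z).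
Proof.
move=> zi S; rewrite ffunE; case: ifPn => mS; last by rewrite eqxx.
move=> h; have {}h : (z : koszul_mod M n) (Defs.down S) != 0.
  by apply: contraNneq h => ->; rewrite scaler0.
rewrite -(zi _ h) -(card_up (Defs.down S)) (cardsD1 ord_max S) mS add1n intS addrC.
congr (_%:Z + _); apply: eq_card => k; case: (unliftP ord_max k) => [l|] ->.
  by rewrite mem_up !inE eq_sym (negPf (neq_lift _ _)).
by rewrite (negPf (max_up _)) finset.setD11.
Qed.

(** The Leibniz rule again, now for the new generator [xi_{n+1}], whose boundary is [v]. *)
Lemma incl_wedge_last (z : koszul M u) : diff (koszul M u) z = 0 ->
  incl v (v *: z) = diff (koszul M (extend u v)) (wedge_last v z).
Proof.
move=> dz; apply/ffunP => S; rewrite !ffunE; case: ifPn => mS.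
  have /ffunP/(_ (Defs.down S)) := dz; rewrite !ffunE => d0.
  (* At a set containing the last index, the boundary of [xi_{n+1} /\ z] is, up to this sign, the
     coefficient of [d z] at [down S], hence 0. *)
  have := congr1 ( *:%R (- (-1) ^+ #|Defs.down S|)) d0.
  rewrite scaler0 => /esym e0; apply: (etrans e0); rewrite scaler_sumr big_mkcond [RHS]big_mkcond.
  rewrite [RHS](bigD1_ord ord_max) //= mS add0r; apply: eq_bigr => j _.
  rewrite inE; case: ifPn => // jS.
  rewrite ffunE in_setU1 mS orbT downU1 pos_lift extend_lift cardsU1 inE jS add1n.
  by rewrite !scalerA exprS; congr (_ *: _); ring.
rewrite (bigD1 ord_max) //= ffunE finset.setU11 downUmax extend_max big1 => [|j /andP[jS jm]].
  rewrite addr0 !scalerA; congr (_ *: _).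
  (* All elements of [S] precede the last index, so the sign of the differential cancels the one in
     [wedge_last]. *)
  have -> : pos ord_max S = #|Defs.down S|.
    rewrite -card_up Defs.downK //; apply: eq_card => k; rewrite !inE.
    case: (unliftP ord_max k) => [l|] ->; first by rewrite lift_max /= ltn_ord andbT.
    by rewrite (negPf mS).
  by rewrite mulrAC -exprMn mulrNN mulr1 expr1n mul1r.
by rewrite ffunE in_setU1 eq_sym (negPf jm) (negPf mS) !scaler0.
Qed.

(** By [connectingE] any lift may be used; [xi_{n+1} /\ z] is a lift of [z] with boundary
    [v *: z]. *)
Lemma gysin_deltaE i (c : Tor M u i) : gysin_delta M u v i c = v *: c.
Proof.
have [z zc <-] := hclass_ofP c; have [zi dz] := zc.
rewrite /gysin_delta hshiftE // -hclass_ofZ //.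
apply: (connectingE (koszul_short_exact M u v) (y := wedge_last v z)).
- exact/is_cycle_shift.
- exact: degZ.
- exact: wedge_last_deg.
- by rewrite /= -[RHS](stripE v 0 z) linear0 add0r.
- exact: incl_wedge_last.
Qed.

(** This and the next two lemmas transport the general exactness along the mutually inverse maps
    [hshift] and [hunshift]. *)
Lemma exact_gysin_delta_tau_up i : exact_at (gysin_delta M u v i) (tau_up M u v i).
Proof.
move=> c; rewrite (exact_connecting_hmap (koszul_short_exact M u v)).
split=> [[e <-]|[e <-]]; last by exists (hshift e).
by exists (hunshift e); rewrite /gysin_delta hunshiftK.
Qed.

Lemma exact_tau_up_tau_down i : exact_at (tau_up M u v (i + 1)) (tau_down M u v i).
Proof.
move=> c; rewrite -(exact_hmap (koszul_short_exact M u v)) /tau_down.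
split=> [h|->]; last exact: hunshift0.
by apply: (can_inj (@hunshiftK _ _ _)); rewrite h hunshift0.
Qed.

Lemma exact_tau_down_gysin_delta i : exact_at (tau_down M u v i) (gysin_delta M u v i).
Proof.
move=> c; rewrite (exact_hmap_connecting (koszul_short_exact M u v)) /tau_down.
split=> -[e]; last by move=> <-; exists e; rewrite hunshiftK.
by move=> h; exists e; rewrite h hshiftK.
Qed.

End GysinSequence.
End KoszulTor.

(** * The degree-2 classes from characters trivial on a subgroup form a group *)

Section Characters.
Variables (R : realType) (m : nat) (H : set 'rV[Cplx R]_m).
Hypothesis HT : closed_subgroup H.

Lemma torus_neq0 t j : H t -> t 0 j != 0.
Proof.
have [HT' _ _ _ _] := HT; move=> /HT'/(_ j) /= tj.
by rewrite -normr_eq0 tj oner_eq0.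
Qed.

Lemma H2B0 : H2B H 0.
Proof.
exists (fun=> 0); split; first by rewrite big1.
by move=> t _; rewrite /chi big1.
Qed.

Lemma H2BD x y : H2B H x -> H2B H y -> H2B H (x + y).
Proof.
move=> [a [-> ha]] [b [-> hb]]; exists (fun j => a j + b j); split.
  by rewrite -big_split; apply: eq_bigr => j _; rewrite mulrzDr.
move=> t Ht; rewrite -[RHS]mulr1 -{1}(ha t Ht) -(hb t Ht) /chi -big_split /=.
by apply: eq_bigr => j _; rewrite expfzDr // torus_neq0.
Qed.

Lemma H2BMz x (k : int) : H2B H x -> H2B H (x *~ k).
Proof.
move=> [a [-> ha]]; exists (fun j => a j * k); split.
  by rewrite mulrz_suml; apply: eq_bigr => j _; rewrite mulrzA.
move=> t Ht; rewrite -(exp1rz _ k) -(ha t Ht) /chi.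
rewrite (big_morph (fun z => z ^ k) (fun x y => expfzMl x y k) (exp1rz _ k)).
by apply: eq_bigr => j _; rewrite exprz_exp.
Qed.

Lemma H2B_sum (p : nat) (u : 'I_p -> HBT m) (c : 'I_p -> int) :
  (forall i, H2B H (u i)) -> H2B H (\sum_i u i *~ c i).
Proof.
move=> uH; apply: (big_ind (H2B H)); [exact: H2B0|exact: H2BD|].
by move=> i _; apply: H2BMz.
Qed.

End Characters.

(** * Comparison of two completions of [u] to a basis *)

Lemma sum_extend (V : zmodType) n (u : 'I_n -> V) v (c : 'I_n.+1 -> int) :
  \sum_i extend u v i *~ c i = \sum_i u i *~ c (lift ord_max i) + v *~ c ord_max.
Proof.
rewrite (bigD1_ord ord_max) //= addrC /extend unlift_none; congr (_ + _).
by apply: eq_bigr => i _; rewrite liftK.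
Qed.

(** The last coordinate of [v'] in the first basis and that of [v] in the second are inverse
    integers, hence both are 1 or both are -1. *)
Lemma basis_extend_unique (V : zmodType) (L : set V) n (u : 'I_n -> V) v v' :
  is_Zbasis L (extend u v) -> is_Zbasis L (extend u v') ->
  exists c : 'I_n -> int,
    v' - v = \sum_i u i *~ c i \/ v' + v = \sum_i u i *~ c i.
Proof.
move=> [Lv Bv] [Lv' Bv'].
have vL : L v by have := Lv ord_max; rewrite /extend unlift_none.
have v'L : L v' by have := Lv' ord_max; rewrite /extend unlift_none.
have [a [va _]] := Bv' _ vL; have [b [vb _]] := Bv _ v'L.
rewrite sum_extend in va; rewrite sum_extend in vb.
have ab : b ord_max * a ord_max = 1.
  have [e [_ uniq_e]] := Bv _ vL.
  (* Two coordinate vectors of [v] in the first basis: the unit vector, and the one obtained by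
     substituting the expansion of [v'] into that of [v]. *)
  pose d1 : {ffun 'I_n.+1 -> int} := [ffun i => (i == ord_max)%:Z].
  pose d2 : {ffun 'I_n.+1 -> int} := [ffun i =>
    (if i == ord_max then 0 else a i) + b i * a ord_max].
  have /uniq_e e1 : v = \sum_i extend u v i *~ d1 i.
    rewrite sum_extend ffunE eqxx big1 ?add0r // => i _.
    by rewrite ffunE eq_sym (negPf (neq_lift _ _)).
  have /uniq_e e2 : v = \sum_i extend u v i *~ d2 i.
    rewrite {1}va {1}vb sum_extend ffunE eqxx add0r mulrzDl mulrz_suml addrA -big_split /=.
    rewrite -mulrzA; congr (_ + _); apply: eq_bigr => i _.
    by rewrite ffunE eq_sym (negPf (neq_lift _ _)) mulrzDr mulrzA.
  have /ffunP/(_ ord_max) : d2 = d1 by rewrite -e1 -e2.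
  by rewrite !ffunE eqxx add0r.
exists (fun i => b (lift ord_max i)).
have : b ord_max \is a GRing.unit by apply/unitrP; exists (a ord_max); rewrite mulrC ab.
rewrite qualifE /= => /orP[]/eqP b1; rewrite vb b1 ?mulr1z ?mulrN1z.
  by left; rewrite addrK.
by right; rewrite subrK.
Qed.

(** * The algebraic Gysin sequence and its dependence on the chosen generator *)

Theorem proposition7p2 (R : realType) (m : nat)
    (U G : set 'rV[Cplx R]_m)
    (HU : closed_subgroup U) (HG : closed_subgroup G) (UG : U `<=` G)
    (GU : quotient_is_circle G U)
    (n : nat) (u : 'I_n -> HBT m) (Hu : is_Zbasis (H2B G) u)
    (v : HBT m) (Hv : is_Zbasis (H2B U) (extend u v))
    (M : lmodType (HBT m)) (gr : int -> set M) (HM : is_grading gr) :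
  [/\ forall i : int,
        [/\ exact_at (gysin_delta M u v (i + 1)) (tau_up M u v (i + 1)),
            exact_at (tau_up M u v (i + 1)) (tau_down M u v i)
          & exact_at (tau_down M u v i) (gysin_delta M u v i)],
      forall (i : int) (c : Tor M u i), gysin_delta M u v i c = v *: c
    & (* a choice of u_{n+1} is a choice of generator of H^2(B(T/U)) / H^2(B(T/G)) = Z
         together with a lift of it; delta only sees the generator *)
      forall v' : HBT m, is_Zbasis (H2B U) (extend u v') ->
        (H2B G (v' - v) /\
           forall (i : int) (c : Tor M u i),
             gysin_delta M u v' i c = gysin_delta M u v i c) \/
        (H2B G (v' + v) /\
           forall (i : int) (c : Tor M u i),
             gysin_delta M u v' i c = - gysin_delta M u v i c)].
Proof.
split=> [i|i c|v' Hv'].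
- by split; [exact: exact_gysin_delta_tau_up|exact: exact_tau_up_tau_down
            |exact: exact_tau_down_gysin_delta].
- exact: gysin_deltaE.
(* In either case [v'] equals [v] or [-v] plus an integral combination of the [u i], which lies in
   [H2B G] and acts on Tor by zero. *)
have [c [e|e]] := basis_extend_unique Hv Hv'; [left|right].
  rewrite e; split=> [|i x]; first by apply: (H2B_sum HG); case: Hu.
  rewrite !gysin_deltaE -[v'](subrK v) e scalerDl.
  by rewrite (@Tor_annihilated_sum _ M n u) add0r.
rewrite e; split=> [|i x]; first by apply: (H2B_sum HG); case: Hu.
rewrite !gysin_deltaE -[v'](addrK v) e scalerBl.
by rewrite (@Tor_annihilated_sum _ M n u) sub0r.
Qed.
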